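(* For every integer $k\ge 1$, there are only finitely many $k$-vertex-critical $(2P_2,\overline{diamond+P_1})$-free graphs.
   Context: Graphs are finite and simple, and ''finitely many'' means up to isomorphism. A graph $G$ is $k$-vertex-critical if $\chi(G)=k$ and $\chi(G-v)<k$ for all $v\in V(G)$, where $\chi$ denotes the chromatic number. A graph is $(H_1,H_2)$-free if it contains no induced subgraph isomorphic to $H_1$ or $H_2$. $2P_2$ is the disjoint union of two edges. The $diamond$ is $K_4$ minus an edge, $diamond+P_1$ is its disjoint union with an isolated vertex, and $\overline{diamond+P_1}$ is the complement of that graph, i.e. the graph obtained from a triangle by attaching two leaves to a single vertex of the triangle. *)

(* Defs.v *)
From HB Require Import structures.
From mathcomp Require Import all_boot.

Set Implicit Arguments.
Unset Strict Implicit.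
Unset Printing Implicit Defensive.

Record graph := Graph {
  vertex :> finType;
  adj : rel vertex;
  adj_sym : symmetric adj;
  adj_irr : irreflexive adj
}.

Definition iso (G H : graph) : Prop :=
  exists2 f : G -> H, bijective f & forall x y, adj (f x) (f y) = adj x y.

Definition induced_adj (G : graph) (A : {set G}) : rel {x : G | x \in A} :=
  fun x y => adj (val x) (val y).
Fact induced_sym (G : graph) (A : {set G}) : symmetric (@induced_adj G A).
Proof. by move=> x y; apply: adj_sym. Qed.
Fact induced_irr (G : graph) (A : {set G}) : irreflexive (@induced_adj G A).
Proof. by move=> x; apply: adj_irr. Qed.
Definition induced (G : graph) (A : {set G}) : graph :=
  Graph (@induced_sym G A) (@induced_irr G A).

Definition delete_vertex (G : graph) (v : G) : graph := induced [set~ v].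

Definition compl_adj (G : graph) : rel G := fun x y => (x != y) && ~~ adj x y.
Fact compl_sym (G : graph) : symmetric (@compl_adj G).
Proof. by move=> x y; rewrite /compl_adj eq_sym adj_sym. Qed.
Fact compl_irr (G : graph) : irreflexive (@compl_adj G).
Proof. by move=> x; rewrite /compl_adj eqxx. Qed.
Definition compl (G : graph) : graph := Graph (@compl_sym G) (@compl_irr G).

Definition union_adj (G H : graph) : rel (G + H)%type := fun x y =>
  match x, y with
  | inl a, inl b => adj a b
  | inr a, inr b => adj a b
  | _, _ => false
  end.
Fact union_sym (G H : graph) : symmetric (@union_adj G H).
Proof. by move=> [a|a] [b|b] //=; apply: adj_sym. Qed.
Fact union_irr (G H : graph) : irreflexive (@union_adj G H).
Proof. by move=> [a|a] /=; apply: adj_irr. Qed.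
Definition disjoint_union (G H : graph) : graph :=
  Graph (@union_sym G H) (@union_irr G H).

Definition delete_edge_adj (G : graph) (u v : G) : rel G := fun x y =>
  [&& adj x y, (x, y) != (u, v) & (y, x) != (u, v)].
Fact delete_edge_sym (G : graph) (u v : G) : symmetric (delete_edge_adj u v).
Proof. by move=> x y; rewrite /delete_edge_adj adj_sym; congr andb; apply: andbC. Qed.
Fact delete_edge_irr (G : graph) (u v : G) : irreflexive (delete_edge_adj u v).
Proof. by move=> x; rewrite /delete_edge_adj adj_irr. Qed.
Definition delete_edge (G : graph) (u v : G) : graph :=
  Graph (@delete_edge_sym G u v) (@delete_edge_irr G u v).

Definition complete_adj n : rel 'I_n := fun i j => i != j.
Fact complete_sym n : symmetric (@complete_adj n).
Proof. by move=> i j; rewrite /complete_adj eq_sym. Qed.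
Fact complete_irr n : irreflexive (@complete_adj n).
Proof. by move=> i; rewrite /complete_adj eqxx. Qed.
Definition complete n : graph := Graph (@complete_sym n) (@complete_irr n).

(* [path_graph n] has [n] vertices, so [path_graph 2] is a single edge. *)
Definition path_adj n : rel 'I_n := fun i j => (i.+1 == j) || (j.+1 == i).
Fact path_sym n : symmetric (@path_adj n).
Proof. by move=> i j; rewrite /path_adj orbC. Qed.
Fact path_irr n : irreflexive (@path_adj n).
Proof. by move=> i; rewrite /path_adj orbb; elim: (i : nat). Qed.
Definition path_graph n : graph := Graph (@path_sym n) (@path_irr n).

Definition two_P2 : graph := disjoint_union (path_graph 2) (path_graph 2).

Definition diamond : graph :=
  @delete_edge (complete 4) (ord0 : 'I_4) (ord_max : 'I_4).

Definition co_diamond_P1 : graph :=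
  compl (disjoint_union diamond (path_graph 1)).

Definition contains_induced (G H : graph) : Prop :=
  exists A : {set G}, iso (induced A) H.

Definition free2 (H1 H2 G : graph) : Prop :=
  ~ contains_induced G H1 /\ ~ contains_induced G H2.

Definition proper (G : graph) k (c : {ffun G -> 'I_k}) : bool :=
  [forall x, forall y, adj x y ==> (c x != c y)].

Definition colorable (G : graph) k : bool :=
  [exists c : {ffun G -> 'I_k}, proper c].

Fact colorable_card (G : graph) : exists k, colorable G k.
Proof.
exists #|G|; apply/existsP; exists [ffun x => enum_rank x].
apply/forallP=> x; apply/forallP=> y; apply/implyP=> exy.
by rewrite !ffunE (inj_eq enum_rank_inj); apply: contraTneq exy => ->; rewrite adj_irr.
Qed.

Definition chromatic_number (G : graph) : nat := ex_minn (colorable_card G).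

Definition vertex_critical k (G : graph) : Prop :=
  chromatic_number G = k /\
  forall v : G, chromatic_number (delete_vertex v) < k.

Definition finitely_many_up_to_iso (P : graph -> Prop) : Prop :=
  exists (n : nat) (F : 'I_n -> graph),
    forall G, P G -> exists i, iso G (F i).

(* Main.v *)
(* Fix a k-colouring, a colour class S, and write N_S(p) for the neighbours of p
   in S. By 2P_2-freeness N_S(p) and N_S(q) are comparable when p, q are
   nonadjacent, so the sets N_S(p), p in a colour class C, form a chain. A chain
   of 6 such sets gives a half graph s_i ~ x_j <-> i <= j with s_0, .., s_4 in S
   and x_0, .., x_4 in C. By criticality some z_i sees s_{i+1} but not s_i; the
   forbidden subgraphs force z_i ~ x_i and make s_0, .., s_{i-1}, s_{i+1} the only
   neighbours of z_i among the s_j, and then the edges x_1 z_1 and x_3 z_3 induce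
   a 2P_2. Hence at most 5k sets N_S(p) occur. By criticality they separate the
   points of S, so |S| <= 2^(5k) and the graph has at most k 2^(5k) vertices. *)
Require Import Defs.
From mathcomp Require Import all_boot.
From mathcomp Require Import zify.

(** * Forbidden induced subgraphs as adjacency rules *)

Lemma contains_induced_inj (G H : graph) (f : H -> G) :
  injective f -> (forall x y, adj (f x) (f y) = adj x y) -> contains_induced G H.
Proof.
move=> f_inj f_adj; pose A := [set f x | x : H]; exists A.
have pre (y : {x : G | x \in A}) : exists x, f x == val y.
  by case: y => y /= /imsetP[x _ ->]; exists x.
pose g y := xchoose (pre y).
have fg y : f (g y) = val y by apply/eqP/(xchooseP (pre y)).
exists g; last by move=> x y; rewrite -f_adj !fg.
have fA x : f x \in A by apply: imset_f.
exists (fun x => exist _ (f x) (fA x)) => [y|x]; first exact/val_inj/fg.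
exact/f_inj/fg.
Qed.

(** Otherwise the edges [p s] and [q t] would induce a $2P_2$. *)
Lemma two_P2_free_adj (G : graph) (p q s t : G) :
    ~ contains_induced G two_P2 -> ~~ adj s t ->
    adj p s -> ~~ adj p t -> adj q t -> ~~ adj q s -> adj p q.
Proof.
move=> free st ps pt qt qs; apply: contraPT free => pq; apply.
pose f (x : two_P2) := match x with
  | inl i => if val i == 0 then p else s
  | inr i => if val i == 0 then q else t end.
have f_adj x y : adj (f x) (f y) = adj x y.
  have [sp tq] : adj s p /\ adj t q by rewrite ![adj _ p]adj_sym ![adj _ q]adj_sym.
  case: x => [[[|[|[]]] ?]|[[|[|[]]] ?]]; case: y => [[[|[|[]]] ?]|[[|[|[]]] ?]] //=;
    rewrite ?adj_irr //; apply/negbTE; rewrite // adj_sym //.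
apply: (@contains_induced_inj _ _ f) => // x y fxy.
(* Distinct vertices of $2P_2$ have distinct neighbourhoods, so adjacency alone gives
   injectivity. *)
have: forall z, adj x z = adj y z by move=> z; rewrite -!f_adj fxy.
case: x {fxy} => [[[|[|[]]] i]|[[|[|[]]] i]]; case: y => [[[|[|[]]] j]|[[|[|[]]] j]] //= H;
  try (by congr (inl _); apply: val_inj); try (by congr (inr _); apply: val_inj);
  by [have:= H (inl ord0) | have:= H (inl ord_max) | have:= H (inr ord0) | have:= H (inr ord_max)].
Qed.

(** Otherwise the triangle [p q r] with leaves [s], [t] at [p] would be an induced [co_diamond_P1],
    also called a cricket. *)
Lemma cricket_free_adj (G : graph) (p q r s t : G) :
    ~ contains_induced G co_diamond_P1 ->
    ~~ adj r s -> ~~ adj r t -> ~~ adj s t -> s != t ->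
    adj p q -> adj p r -> adj q r -> adj p s -> adj p t -> adj q s || adj q t.
Proof.
move=> free rs rt st s_t pq pr qr ps pt.
apply: contraPT free; rewrite negb_or => /andP[qs qt]; apply.
(* Complementing makes the isolated vertex the centre [p], the deleted diamond edge 0-3 the edge
   [q r], and 1, 2 the leaves. *)
pose f (x : co_diamond_P1) := match x with
  | inl i => nth p [:: q; s; t; r] (val i)
  | inr i => p end.
have rq : adj r q by rewrite adj_sym.
have f_adj x y : adj (f x) (f y) = adj x y.
  case: x => [[[|[|[|[|[]]]]] ?]|[[|[]] ?]]; case: y => [[[|[|[|[|[]]]]] ?]|[[|[]] ?]] //=;
    rewrite /= ?adj_irr // ?[adj _ p]adj_sym //;
    apply/negbTE => //; by rewrite adj_sym.
(* The leaves are twins, so adjacency does not separate them; [s != t] enters here. *)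
have U : uniq [:: q; s; t; r; p].
  have neq_adj (u v w : G) : adj u w -> ~~ adj v w -> u != v.
    by move=> uw; apply: contraNneq => <-.
  have adj_neq (u v : G) : adj u v -> u != v by apply: contraTneq => ->; rewrite adj_irr.
  rewrite /= !inE !negb_or s_t (adj_neq q r qr) ![_ == p]eq_sym (adj_neq p q) // (adj_neq p r) // (adj_neq p s) // (adj_neq p t) // [s == r]eq_sym [t == r]eq_sym.
  have [qs' qt'] : q != s /\ q != t by split; apply: neq_adj qr _; rewrite adj_sym.
  have [rs' rt'] : r != s /\ r != t by split; apply: neq_adj rq _; rewrite adj_sym.
  by rewrite qs' qt' rs' rt'.
pose h (x : co_diamond_P1) := match x with inl i => val i | inr i => 4 end.
have fE x : f x = nth p [:: q; s; t; r; p] (h x).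
  by case: x => [[[|[|[|[|[]]]]] ?]|i].
have h_lt x : h x < 5 by case: x => [[[|[|[|[|[]]]]] ?]|i].
apply: (@contains_induced_inj _ _ f) => // x y /eqP.
rewrite !fE nth_uniq //; case: x => x; case: y => y /=.
- by move/eqP/val_inj => ->.
- by rewrite ltn_eqF.
- by rewrite gtn_eqF.
- by rewrite (ord1 x) (ord1 y).
Qed.

(** * Exclusion of a half graph *)

Lemma half_graph_contra (G : graph) (s x : nat -> G) :
    free2 two_P2 co_diamond_P1 G ->
    (forall u v : G, u != v -> exists2 z, adj u z & ~~ adj v z) ->
    (forall i j, i < 5 -> j < 5 -> ~~ adj (s i) (s j)) ->
    (forall i j, i < 5 -> j < 5 -> ~~ adj (x i) (x j)) ->
    (forall i j, i < 5 -> j < 5 -> adj (x j) (s i) = (i <= j)) -> False.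
Proof.
move=> [/two_P2_free_adj P2F /cricket_free_adj CF] inc Ss Xx xs.
have sx i j : i < 5 -> j < 5 -> adj (s i) (x j) = (i <= j).
  by move=> i5 j5; rewrite adj_sym xs.
have s_neq i j : i < j < 5 -> s i != s j.
  move=> /andP[ij j5]; have i5 := ltn_trans ij j5; apply: contraTneq (leqnn i) => sij.
  by rewrite -xs // sij xs // -ltnNge.
have x_neq i j : i < j < 5 -> x i != x j.
  move=> /andP[ij j5]; have i5 := ltn_trans ij j5; apply: contraTneq (leqnn j) => xij.
  by rewrite -sx // -xij sx // -ltnNge.
(* Otherwise the triangle [p], [q], [s i] with leaves [s j], [s k] at [p] is a cricket. *)
have crossS p q i j k : i < 5 -> j < k < 5 -> adj p (s i) -> adj q (s i) ->
    adj p (s j) -> adj p (s k) -> ~~ adj q (s j) -> ~~ adj q (s k) -> ~~ adj p q.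
  move=> i5 jk pi qi pj pk qj qk; apply/negP => pq; have /andP[jk' k5] := jk.
  have j5 := ltn_trans jk' k5.
  have := CF p q (s i) (s j) (s k) (Ss _ _ i5 j5) (Ss _ _ i5 k5) (Ss _ _ j5 k5) (s_neq _ _ jk) pq pi qi pj pk.
  by rewrite (negbTE qj) (negbTE qk).
have key i : 0 < i < 4 -> exists2 z, adj z (x i) &
    forall j, j < 5 -> adj z (s j) = (j < i) || (j == i.+1).
  move=> /andP[i0 i4]; have i5 := ltnW i4.
  have ss : s i.+1 != s i by rewrite eq_sym s_neq // ltnSn.
  have [z] := inc _ _ ss.
  rewrite ![adj (s _) _]adj_sym => zi1 zi.
  (* Otherwise the edges from [z] to [s i.+1] and from [x j] to [s j] induce a $2P_2$. *)
  have zx j : j <= i -> adj z (s j) = false -> adj z (x j).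
    move=> ji zj; apply: (P2F z (x j) (s i.+1) (s j)); rewrite ?zj //.
    - by apply: Ss => //; lia.
    - by rewrite xs //; lia.
    - by rewrite xs //; lia.
  have zxi := zx i (leqnn i) (negbTE zi).
  exists z => //.
  (* If [z] misses [s_0, .., s_i] it sees [x_0, .., x_i], hence [x_{i+1}], and the
     triangle [z, s_{i+1}, x_{i+1}] with leaves [x_0, x_1] is a cricket. *)
  have [[j ji zj]|none] : (exists2 j, j < i & adj z (s j)) \/ (forall j, j < i -> ~~ adj z (s j)).
    case: (boolP [exists j : 'I_i, adj z (s j)]) => [/existsP[j zj]|/existsPn no_nb].
      by left; exists j.
    by right=> j ji; apply: (no_nb (Ordinal ji)).
  - have j5 : j < 5 by lia.
    (* With [s j] as common neighbour, [crossS] rules out two cases: [x i] sees [s l], [s i] and [z]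
       misses both, or [z] sees [s i.+1], [s l] and [x i] misses both. *)
    move=> l l5; case: (ltngtP l i) => [li|il|->] /=; last by rewrite (negbTE zi); lia.
    + apply: contraTT zxi => zl; rewrite adj_sym.
      by apply: (crossS _ _ j l i) => //; rewrite ?xs //; lia.
    + have [->|ni] := eqVneq l i.+1; first by rewrite zi1.
      apply: contraTF zxi => zl.
      by apply: (crossS _ _ j i.+1 l) => //; rewrite ?xs //; lia.
  - have zx0 j : j <= i -> adj z (x j).
      rewrite leq_eqVlt => /orP[/eqP->//|ji]; apply: zx; first exact: ltnW.
      exact/negbTE/none.
    (* Otherwise [z x_0] and [s_i x_{i+1}] induce a $2P_2$; [s_i] misses [x_0] as [i > 0]. *)
    have zx1 : adj z (x i.+1).
      apply: contraNT zi => zx1.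
      apply: (P2F z (s i) (x 0) (x i.+1)) => //; rewrite ?Xx ?sx ?zx0 //; lia.
    have := CF z (s i.+1) (x i.+1) (x 0) (x 1).
    rewrite !Xx ?x_neq ?zi1 ?zx1 ?sx ?zx0 //; lia.
(* The gap between 1 and 3 leaves two leaves for each use of [crossS] with common neighbour [s_0]:
   [s_1], [s_4] for [z3] against [z1], [s_2], [s_4] for [z3] against [x_1], and [s_1], [s_3] for
   [x_3] against [z1]. *)
have [//|z1 z1x z1s] := key 1.
have [//|z3 z3x z3s] := key 3.
have: adj (x 1) (x 3).
  apply: (P2F _ _ z1 z3); rewrite 1?[adj (x _) _]adj_sym //.
  - rewrite adj_sym; apply: (crossS _ _ 0 1 4) => //; rewrite ?z1s ?z3s //.
  - apply: (crossS _ _ 0 2 4) => //; rewrite ?z3s ?xs //.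
  - rewrite adj_sym; apply: (crossS _ _ 0 1 3) => //; rewrite ?z1s ?xs //.
by rewrite (negbTE (Xx _ _ _ _)).
Qed.

(** * Criticality and neighbourhoods *)

Lemma chromatic_number_min (G : graph) n : colorable G n -> chromatic_number G <= n.
Proof. by rewrite /chromatic_number; case: ex_minnP => m _; apply. Qed.

Lemma colorable_chromatic_number (G : graph) : colorable G (chromatic_number G).
Proof. by rewrite /chromatic_number; case: ex_minnP. Qed.

(** If every neighbour of [u] were a neighbour of [v], an optimal colouring of $G-u$ would extend to
    [u] by the colour of [v]; the map [d] folds [u] onto [v]. *)
Lemma critical_incomparable k (G : graph) (u v : G) :
  vertex_critical k G -> u != v -> exists2 z, adj u z & ~~ adj v z.
Proof.
move=> [chiG crit] uv; apply/exists_inP; apply: contraT => /exists_inPn /= uv_sub.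
have sub z : adj u z -> adj v z by move/uv_sub; rewrite negbK.
have := crit u; rewrite -chiG ltnNge => /negP[]; apply: chromatic_number_min.
have /existsP[c /forallP c_proper] := colorable_chromatic_number (delete_vertex u).
have mem_del w : (if w == u then v else w) \in [set~ u].
  by rewrite !inE; have [_|//] := eqVneq w u; rewrite eq_sym.
pose d w : delete_vertex u := exist (fun x => x \in [set~ u]) _ (mem_del w).
apply/existsP; exists [ffun w => c (d w)].
apply/forallP => x; apply/forallP => y; apply/implyP => xy; rewrite !ffunE.
have /forallP/(_ (d y))/implyP := c_proper (d x); apply.
rewrite /= /induced_adj /=.
case: eqP xy => [->|_]; case: eqP => [->|_] //; first by rewrite adj_irr.
  exact: sub.
by rewrite adj_sym => /sub; rewrite adj_sym.
Qed.

(** * Chains of neighbourhoods in a colour class *)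

Lemma subset_chain_enum (T : finType) (V : {set {set T}}) :
    {in V &, forall A B : {set T}, (A \subset B) || (B \subset A)} ->
  exists A : nat -> {set T}, (forall i, i < #|V| -> A i \in V) /\
    (forall i j, i < j < #|V| -> A i \proper A j).
Proof.
move=> V_total; pose r := fun A B : {set T} => A \subset B.
pose L := sort r (enum V); have sizeL : size L = #|V| by rewrite size_sort -cardE.
have L_sorted : sorted r L.
  apply: (@sort_sorted_in _ (mem V)); first by move=> A B AV BV; apply: V_total.
  by apply/allP => A; rewrite mem_enum.
exists (nth set0 L); split=> [i iV|i j /andP[ij jV]].
  by rewrite -mem_enum -(mem_sort r) mem_nth // sizeL.
have r_trans : transitive r by move=> A B C; apply: subset_trans.
have iV := ltn_trans ij jV.
rewrite properEneq nth_uniq ?sizeL ?sort_uniq ?enum_uniq // neq_ltn ij /=.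
by apply: (sorted_ltn_nth r_trans) => //; rewrite inE sizeL.
Qed.

Definition independent (G : graph) (S : {set G}) := {in S &, forall x y, ~~ adj x y}.

(** Six sets $A_0 \subset \dots \subset A_5$ of the chain give five pairs: [x i] realises $A_{i+1}$
    and [s i] lies in $A_{i+1} \setminus A_i$, so [s i] sees [x j] exactly when [i <= j]. *)
Lemma card_nbhds_le (k : nat) (G : graph) (S C : {set G}) :
    vertex_critical k G -> free2 two_P2 co_diamond_P1 G ->
    independent G S -> independent G C ->
  #|[set [set s in S | adj p s] | p in C]| <= 5.
Proof.
move=> crit free indS indC; set V := imset _ _; rewrite leqNgt; apply/negP => V5.
have [|A [AV A_proper]] := @subset_chain_enum _ V.
  move=> _ _ /imsetP[p pC ->] /imsetP[q qC ->]; apply: contraT.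
  rewrite negb_or => /andP[/subsetPn[s] + + /subsetPn[t]]; rewrite !inE.
  move=> /andP[sS ps]; rewrite sS => qs /andP[tS qt]; rewrite tS => pt.
  by move: (indC _ _ pC qC); rewrite (two_P2_free_adj G p q s t free.1 (indS _ _ sS tS)).
have A_sub i j : i <= j < 6 -> A i \subset A j.
  rewrite leq_eqVlt => /andP[/orP[/eqP->//|ij] j6].
  by rewrite proper_sub // A_proper // ij (leq_trans j6).
have [x xP] : exists x : 'I_5 -> G, forall i, x i \in C /\ A i.+1 = [set s in S | adj (x i) s].
  apply: (@fin_all_exists 'I_5 (fun=> G) (fun i y => y \in C /\ A i.+1 = [set s in S | adj y s])) => i.
  by have /imsetP[y] := AV i.+1 (leq_trans (ltn_ord i : i.+1 < 6) V5); exists y.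
have [s sP] : exists s : 'I_5 -> G, forall i, s i \in A i.+1 /\ s i \notin A i.
  apply: (@fin_all_exists 'I_5 (fun=> G) (fun i y => y \in A i.+1 /\ y \notin A i)) => i.
  have /properP[_ [y y1 y2]] : A i \proper A i.+1 by rewrite A_proper // ltnSn (leq_trans (ltn_ord i : i.+1 < 6) V5).
  by exists y.
have sS i : s i \in S by have := (sP i).1; rewrite (xP i).2 inE => /andP[].
apply: (half_graph_contra G (s \o inord) (x \o inord) free) => [u v|i j _ _|i j _ _|i j i5 j5] /=.
- exact: critical_incomparable crit.
- exact: indS.
- by apply: indC; apply: (xP _).1.
have [_ Aj] := xP (inord j); have [si sNi] := sP (inord i).
have -> : adj (x (inord j)) (s (inord i)) = (s (inord i) \in A j.+1).
  by rewrite -(@inordK 4 j) // Aj inE sS inordK.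
move: si sNi; rewrite inordK // => si sNi; case: leqP => ij.
  by apply: subsetP si; apply: A_sub; rewrite ltnS ij.
apply: contraNF sNi; apply: subsetP; apply: A_sub.
by rewrite ij ltnW.
Qed.

(** * Bounding the order, then counting graphs *)

Lemma card_free_critical k (G : graph) :
    vertex_critical k G -> free2 two_P2 co_diamond_P1 G ->
  #|G| <= k * 2 ^ (5 * k).
Proof.
move=> crit free; have := colorable_chromatic_number G; rewrite crit.1.
case/existsP => c /forallP c_proper; pose C i := [set x | c x == i].
have indC i : independent G (C i).
  move=> x y; rewrite !inE => /eqP xi /eqP yi; have /forallP/(_ y) := c_proper x.
  by rewrite xi yi eqxx implybF.
have cardC i : #|C i| <= 2 ^ (5 * k).
  pose nb (p : G) := [set s in C i | adj p s].
  pose V := [set nb p | p : G].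
  have cardV : #|V| <= 5 * k.
    have -> : V = \bigcup_(j < k) [set nb p | p in C j].
      apply/setP => A; apply/imsetP/bigcupP => [[p _ ->]|[j _ /imsetP[p _ ->]]]; last by exists p.
      by exists (c p) => //; apply: imset_f; rewrite inE.
    apply: (@leq_trans (\sum_(j < k) 5)); last by rewrite sum_nat_const card_ord mulnC.
    apply: (big_ind2 (fun (A : {set {set G}}) n => #|A| <= n)) => [|A m B n Am Bn|j _].
    - by rewrite cards0.
    - exact: leq_trans (leq_card_setU A B) (leq_add Am Bn).
    - exact: card_nbhds_le crit free _ _.
  (* [tr] is injective on the class: a [z] seeing [s] but not [t] puts [nb z] in [tr s] only. *)
  pose tr s := [set A in V | s \in A].
  have nbE z s : s \in C i -> (nb z \in tr s) = adj z s.
    by move=> sC; rewrite inE imset_f //= inE sC.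
  have tr_inj : {in C i &, injective tr}.
    move=> s t sC tC st; apply/eqP/idPn => s_t.
    have [z sz tz] := critical_incomparable k G s t crit s_t.
    by have := nbE z s sC; rewrite st nbE // ![adj z _]adj_sym sz (negbTE tz).
  rewrite -(card_in_imset tr_inj); apply: (@leq_trans #|powerset V|).
    by apply/subset_leq_card/subsetP => _ /imsetP[s _ ->]; rewrite inE /tr setIdE subsetIl.
  by rewrite card_powerset leq_exp2l.
rewrite -sum1_card (partition_big c predT) //=.
apply: (@leq_trans (\sum_(i < k) 2 ^ (5 * k))); last by rewrite sum_nat_const card_ord.
apply: leq_sum => i _; apply: leq_trans (cardC i).
by rewrite -sum1_card; under [leqRHS]eq_bigl do rewrite inE.
Qed.

(** Symmetrising and removing loops turns every boolean table into a graph, so finitely many tables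
    cover all graphs of order [n]. *)
Definition table_adj n (f : {ffun 'I_n * 'I_n -> bool}) : rel 'I_n :=
  fun i j => (i != j) && (f (i, j) || f (j, i)).

Lemma table_sym n f : symmetric (table_adj n f).
Proof. by move=> i j; rewrite /table_adj eq_sym orbC. Qed.

Lemma table_irr n f : irreflexive (table_adj n f).
Proof. by move=> i; rewrite /table_adj eqxx. Qed.

Definition table_graph n f : graph :=
  Graph (table_sym n f) (table_irr n f).

Lemma iso_table_graph (G : graph) : exists f, iso G (table_graph #|G| f).
Proof.
exists [ffun ij => adj (enum_val ij.1) (enum_val ij.2)], enum_rank.
  by exists enum_val; [apply: enum_rankK | apply: enum_valK].
move=> x y; rewrite /= /table_adj !ffunE /= !enum_rankK (inj_eq enum_rank_inj).
by rewrite [adj y x]adj_sym orbb; case: eqP => // ->; rewrite adj_irr.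
Qed.

Lemma finitely_many_bounded (P : graph -> Prop) N :
  (forall G, P G -> #|G| <= N) -> finitely_many_up_to_iso P.
Proof.
move=> P_le; pose T := {n : 'I_N.+1 & {ffun 'I_n * 'I_n -> bool}}.
exists #|{: T}|, (fun i => let f : T := enum_val i in table_graph (tag f) (tagged f)) => G /P_le leN.
have [f isoG] := iso_table_graph G.
exists (enum_rank (existT _ (Ordinal (leN : #|G| < N.+1)) f : T)).
by rewrite /= enum_rankK.
Qed.

Theorem corollary5p3 (k : nat) (hk : 1 <= k) :
  finitely_many_up_to_iso
    (fun G : graph => vertex_critical k G /\ free2 two_P2 co_diamond_P1 G).
Proof.
apply: (@finitely_many_bounded _ (k * 2 ^ (5 * k))) => G [crit free].
exact: card_free_critical.
Qed.
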